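(* Let $n\ge2$ be an integer, $p$ a prime with $p>n+1$, $m^0=(1,\dots,1)\in\mathbb{Z}_{>0}^n$ (so $|m^0|=n$), and let $z^0=(z^0_1,\dots,z^0_n)\in\mathbb{F}_p^n$ have distinct coordinates. Let $T(t)=\prod_{s=1}^n(t-z^0_s)$. Then there are isomorphisms of algebras $$\mathcal{A}(z^0,m^0)\cong\mathcal{B}(z^0,m^0)\cong\mathcal{C}(T),$$ and the $\mathcal{B}(z^0,m^0)$-module $\operatorname{Sing}L^{\otimes m^0}[|m^0|-2]$ is isomorphic to the regular representation of the algebra $\mathcal{C}(T)$ (that is, there are an algebra isomorphism $\psi:\mathcal{C}(T)\to\mathcal{B}(z^0,m^0)$ and a linear isomorphism $\varphi:\mathcal{C}(T)\to\operatorname{Sing}L^{\otimes m^0}[|m^0|-2]$ with $\varphi(gh)=\psi(g).\varphi(h)$ for all $g,h\in\mathcal{C}(T)$).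
   Context: The Lie algebra $\mathfrak{sl}_2$ is considered over $\mathbb{F}_p$, with basis $e,f,h$ and $[e,f]=h$, $[h,e]=2e$, $[h,f]=-2f$. $L_1$ is the two-dimensional module with basis $v_1,fv_1$ and $h.v_1=v_1$, $h.fv_1=-fv_1$, $f.v_1=fv_1$, $f.fv_1=0$, $e.v_1=0$, $e.fv_1=v_1$. $L^{\otimes m^0}=L_1^{\otimes n}$. Put $L^{\otimes m^0}[n-2]=\{v: h.v=(n-2)v\}$ and $\operatorname{Sing}L^{\otimes m^0}[|m^0|-2]=\{v\in L^{\otimes m^0}[n-2] : e.v=0\}$. Let $\Omega=e\otimes f+f\otimes e+\frac12h\otimes h$, and let $\Omega^{(i,j)}=\Omega^{(j,i)}$ act on $L^{\otimes m^0}$ as $\Omega$ in the $i$-th and $j$-th factors and as the identity elsewhere. The Gaudin Hamiltonians are $H_s(z^0)=\sum_{l\ne s}\frac{\Omega^{(s,l)}}{z^0_s-z^0_l}$, $s=1,\dots,n$; they commute and preserve $\operatorname{Sing}L^{\otimes m^0}[|m^0|-2]$. The Bethe algebra $\mathcal{B}(z^0,m^0)$ is the subalgebra of $\operatorname{End}(\operatorname{Sing}L^{\otimes m^0}[|m^0|-2])$ generated over $\mathbb{F}_p$ by the restrictions of the $H_s(z^0)$ and the identity. Let $\mathcal{O}(U)=\mathbb{F}_p[t]\big[\prod_s(t-z^0_s)^{-1}\big]$ be the ring of rational functions in $t$ regular on the affine line minus $\{z^0_1,\dots,z^0_n\}$. Put $\mathcal{A}(z^0,m^0)=\mathcal{O}(U)/(P(t))$,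 where $P(t)=\sum_{s=1}^n\prod_{l\ne s}(t-z^0_l)=\frac{dT}{dt}(t)$. For a monic polynomial $T(x)=x^n+\sigma_1x^{n-1}+\dots+\sigma_n\in\mathbb{F}_p[x]$, the algebra $\mathcal{C}(T)=\mathbb{F}_p[t,a_1,\dots,a_{n-2},a_n]/I$ is defined as follows. Put $g_1(x)=x^n+a_1x^{n-1}+\dots+a_{n-2}x^2+a_n$, $g_2(x)=x-t$, and $\operatorname{Wr}(g_1,g_2)=g_1'g_2-g_1g_2'$ (derivatives in $x$). $I$ is the ideal generated by the coefficients, as a polynomial in $x$, of $\operatorname{Wr}(g_1(x),g_2(x))-(n-1)T(x)$; explicitly, with $a_0=1$, $I$ is generated by the $n$ polynomials $(n-r-1)a_r-(n-r+1)a_{r-1}t-(n-1)\sigma_r$ for $r=1,\dots,n-1$ (the term with $a_{n-1}$ has coefficient $0$) and $a_n+(n-1)\sigma_n$. *)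

(* Defs.v *)
From HB Require Import structures.
From mathcomp Require Import all_boot all_order all_algebra all_field.
From mathcomp Require Import boolp mpoly.

Set Implicit Arguments.
Unset Strict Implicit.
Unset Printing Implicit Defensive.

Import GRing.Theory.
Local Open Scope ring_scope.
Local Open Scope quotient_scope.

(* The library's lalgType and algType require 1 != 0. For the Bethe algebra and
   for the two quotient algebras below this is a consequence of the hypotheses
   on n, p and z rather than of the construction, so these three carry a
   pzRingType and an lmodType structure, compatible by the lemmas
   *_scalerAl, *_scalerAr. *)
Notation alg_iso f := [/\ linear f, monoid_morphism f & bijective f].

Section GeneratedSubalgebra.

Variables (F : fieldType) (A : comAlgType F) (gens : seq A).

Definition gen_subalg : {pred A} := fun x =>
  `[< forall S : {pred A},
        GRing.subalg_closed S -> {subset gens <= S} -> x \in S >].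

Lemma mem_gen_subalg x : x \in gens -> x \in gen_subalg.
Proof. by move=> gx; apply/asboolP => S _; apply. Qed.

Fact gen_subalg_closed : GRing.subalg_closed gen_subalg.
Proof.
split=> [|a x y /asboolP Gx /asboolP Gy|x y /asboolP Gx /asboolP Gy];
  apply/asboolP => S sS GS; case: (sS) => S1 SD SM //.
- by apply: SD; [apply: Gx | apply: Gy].
- by apply: SM; [apply: Gx | apply: Gy].
Qed.

HB.instance Definition _ :=
  GRing.isSubringClosed.Build A gen_subalg
    (GRing.subalg_closedBM gen_subalg_closed).
HB.instance Definition _ :=
  GRing.isSubmodClosed.Build F A gen_subalg
    (GRing.subalg_closedZ gen_subalg_closed).

Definition subalg := {x : A | x \in gen_subalg}.

HB.instance Definition _ := SubChoice.on subalg.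
HB.instance Definition _ := [SubChoice_isSubComNzRing of subalg by <:].
HB.instance Definition _ := [SubZmodule_isSubLmodule of subalg by <:].
HB.instance Definition _ := [SubNzRing_SubLmodule_isSubLalgebra of subalg by <:].
HB.instance Definition _ := [SubLalgebra_isSubAlgebra of subalg by <:].
HB.instance Definition _ := GRing.ComNzRing.on subalg.

End GeneratedSubalgebra.

Section QuotientAlgebra.

Variables (F : fieldType) (A : comAlgType F) (gens : seq A).

Definition gen_ideal : {pred A} := fun x =>
  `[< exists c : 'I_(size gens) -> A, x = \sum_i c i * gens`_i >].

Fact gen_ideal_zmod_closed : zmod_closed gen_ideal.
Proof.
split=> [|x y /asboolP[c ->] /asboolP[d ->]]; apply/asboolP.
  by exists (fun=> 0); rewrite big1 // => i _; rewrite mul0r.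
exists (fun i => c i - d i); rewrite -sumrB; apply: eq_bigr => i _.
by rewrite mulrBl.
Qed.

HB.instance Definition _ :=
  GRing.isZmodClosed.Build A gen_ideal gen_ideal_zmod_closed.

Lemma gen_idealMl a x : x \in gen_ideal -> a * x \in gen_ideal.
Proof.
move=> /asboolP[c ->]; apply/asboolP; exists (fun i => a * c i).
by rewrite mulr_sumr; apply: eq_bigr => i _; rewrite mulrA.
Qed.

Definition quot_alg := Quotient.quot gen_ideal.

HB.instance Definition _ := GRing.Zmodule.on quot_alg.
HB.instance Definition _ := Quotient.on quot_alg.

Definition quot_pi (x : A) : quot_alg := \pi_quot_alg x.

Lemma quot_piP x y : reflect (quot_pi x = quot_pi y) (x - y \in gen_ideal).
Proof. by rewrite Quotient.idealrBE; apply: eqP. Qed.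

Lemma quot_reprK x : quot_pi (repr x) = x.
Proof. exact: reprK. Qed.

Fact quot_piB : zmod_morphism quot_pi.
Proof. by move=> x y; rewrite /quot_pi !piE. Qed.

HB.instance Definition _ :=
  GRing.isZmodMorphism.Build A quot_alg quot_pi quot_piB.

Lemma gen_ideal_repr x : repr (quot_pi x) - x \in gen_ideal.
Proof. by apply/quot_piP; rewrite quot_reprK. Qed.

Definition quot_mul (x y : quot_alg) := quot_pi (repr x * repr y).
Definition quot_scale (a : F) (x : quot_alg) := quot_pi (a *: repr x).

Fact quot_piM x y : quot_pi (x * y) = quot_mul (quot_pi x) (quot_pi y).
Proof.
apply/esym/quot_piP; set x' := repr _; set y' := repr _.
have ->: x' * y' - x * y = y' * (x' - x) + x * (y' - y).
  by rewrite !mulrBr addrA [y' * x']mulrC [y' * x]mulrC addrNK.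
by rewrite rpredD // gen_idealMl // gen_ideal_repr.
Qed.

Fact quot_piZ a x : quot_pi (a *: x) = quot_scale a (quot_pi x).
Proof.
apply/esym/quot_piP; rewrite -scalerBr -mulr_algl gen_idealMl //.
exact: gen_ideal_repr.
Qed.

Fact quot_mulA : associative quot_mul.
Proof.
move=> x y z; rewrite -[x]quot_reprK -[y]quot_reprK -[z]quot_reprK.
by rewrite -!quot_piM mulrA.
Qed.

Fact quot_mulC : commutative quot_mul.
Proof. by move=> x y; rewrite /quot_mul mulrC. Qed.

Fact quot_mul1 : left_id (quot_pi 1) quot_mul.
Proof. by move=> x; rewrite -[x]quot_reprK -quot_piM mul1r. Qed.

Fact quot_mulDl : left_distributive quot_mul +%R.
Proof.
move=> x y z; rewrite -[x]quot_reprK -[y]quot_reprK -[z]quot_reprK.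
by rewrite -raddfD -!quot_piM mulrDl raddfD.
Qed.

HB.instance Definition _ :=
  GRing.Zmodule_isComPzRing.Build quot_alg
    quot_mulA quot_mulC quot_mul1 quot_mulDl.

Fact quot_scaleA a b x : quot_scale a (quot_scale b x) = quot_scale (a * b) x.
Proof. by rewrite -[x]quot_reprK -!quot_piZ scalerA. Qed.

Fact quot_scale1 : left_id 1 quot_scale.
Proof. by move=> x; rewrite -[x]quot_reprK -quot_piZ scale1r. Qed.

Fact quot_scaleDr : right_distributive quot_scale +%R.
Proof.
move=> a x y; rewrite -[x]quot_reprK -[y]quot_reprK.
by rewrite -raddfD -!quot_piZ scalerDr raddfD.
Qed.

Fact quot_scaleDl x : {morph quot_scale^~ x : a b / a + b}.
Proof.
by move=> a b /=; rewrite -[x]quot_reprK -!quot_piZ scalerDl raddfD.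
Qed.

HB.instance Definition _ :=
  GRing.Zmodule_isLmodule.Build F quot_alg
    quot_scaleA quot_scale1 quot_scaleDr quot_scaleDl.

Lemma quot_pi_linear : linear quot_pi.
Proof. by move=> a x y; rewrite raddfD /= quot_piZ. Qed.

Lemma quot_pi_monoid_morphism : monoid_morphism quot_pi.
Proof. by split=> // x y; rewrite quot_piM. Qed.

Lemma quot_scalerAl a (x y : quot_alg) : a *: (x * y) = (a *: x) * y.
Proof.
rewrite -[x]quot_reprK -[y]quot_reprK; change
  (quot_scale a (quot_mul (quot_pi (repr x)) (quot_pi (repr y))) =
   quot_mul (quot_scale a (quot_pi (repr x))) (quot_pi (repr y))).
by rewrite -quot_piM -!quot_piZ -quot_piM scalerAl.
Qed.

Lemma quot_scalerAr a (x y : quot_alg) : a *: (x * y) = x * (a *: y).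
Proof. by rewrite mulrC quot_scalerAl mulrC. Qed.

End QuotientAlgebra.

Section RationalFunctions.

Variable F : fieldType.

Definition ratfun := {fraction {poly F}}.

HB.instance Definition _ := GRing.Field.on ratfun.

Definition ratfun_poly (q : {poly F}) : ratfun := tofrac q.

Definition ratfun_scale (a : F) (x : ratfun) : ratfun := ratfun_poly a%:P * x.

Fact ratfun_scaleA a b x :
  ratfun_scale a (ratfun_scale b x) = ratfun_scale (a * b) x.
Proof. by rewrite /ratfun_scale /ratfun_poly mulrA -rmorphM -polyCM. Qed.

Fact ratfun_scale1 : left_id 1 ratfun_scale.
Proof. by move=> x; rewrite /ratfun_scale /ratfun_poly polyC1 rmorph1 mul1r. Qed.

Fact ratfun_scaleDr : right_distributive ratfun_scale +%R.
Proof. by move=> a x y; rewrite /ratfun_scale mulrDr. Qed.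

Fact ratfun_scaleDl x : {morph ratfun_scale^~ x : a b / a + b}.
Proof.
by move=> a b; rewrite /ratfun_scale /ratfun_poly polyCD rmorphD mulrDl.
Qed.

HB.instance Definition _ :=
  GRing.Zmodule_isLmodule.Build F ratfun
    ratfun_scaleA ratfun_scale1 ratfun_scaleDr ratfun_scaleDl.

Fact ratfun_scalerAl a (x y : ratfun) : a *: (x * y) = (a *: x) * y.
Proof. exact: mulrA. Qed.

HB.instance Definition _ :=
  GRing.Lmodule_isLalgebra.Build F ratfun ratfun_scalerAl.
HB.instance Definition _ := GRing.Lalgebra_isComAlgebra.Build F ratfun.

End RationalFunctions.

Section AlgebraA.

Variables (F : fieldType) (n : nat) (z : 'I_n -> F).

Definition OU_gens : seq (ratfun F) :=
  [:: ratfun_poly 'X; (\prod_(s < n) ratfun_poly ('X - (z s)%:P))^-1].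

Definition OU := subalg OU_gens.

Fact OU_t_subproof : ratfun_poly 'X \in gen_subalg OU_gens.
Proof. by apply: mem_gen_subalg; rewrite mem_head. Qed.

Definition OU_t : OU := Sub (ratfun_poly 'X) OU_t_subproof.

Definition OU_P : OU := \sum_(s < n) \prod_(l < n | l != s) (OU_t - (z l)%:A).

Definition OU_quot := quot_alg [:: OU_P].

End AlgebraA.

Section AlgebraC.

Variables (F : fieldType) (n : nat).

Let R := {mpoly F[n.-2.+2]}.

(* For n >= 2 there are n variables: number 0 is t, number r is a_r for
   1 <= r <= n-2, and number n-1 is a_n. *)
Definition C_t : R := 'X_ord0.
Definition C_a (r : nat) : R := 'X_(inord r).
Definition C_an : R := 'X_ord_max.

Definition g1 : {poly R} :=
  'X^n + \sum_(1 <= r < n.-1) C_a r *: 'X^(n - r) + C_an%:P.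
Definition g2 : {poly R} := 'X - C_t%:P.

Definition Wr (f g : {poly R}) : {poly R} := f^`() * g - f * g^`().

Definition C_rel (T : {poly F}) : {poly R} :=
  Wr g1 g2 - (n%:R - 1) *: map_poly (@mpolyC n.-2.+2 F) T.

(* C_rel T, coerced to seq, is the list of its coefficients. *)
Definition wronski_alg (T : {poly F}) := quot_alg (C_rel T).

End AlgebraC.

Section Gaudin.

Variables (F : fieldType) (n : nat).

(* Matrices, acting on columns, in the basis v_1 (index 0), f v_1 (index 1) of
   L_1. *)
Definition sl2_e : 'M[F]_2 := delta_mx 0 1.
Definition sl2_f : 'M[F]_2 := delta_mx 1 0.
Definition sl2_h : 'M[F]_2 := delta_mx 0 0 - delta_mx 1 1.

(* A tensor is given by its coordinates in the basis of the elementary tensors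
   of basis vectors, which are indexed by b : {ffun 'I_n -> 'I_2}. *)
Definition tens := {ffun {ffun 'I_n -> 'I_2} -> F^o}.

HB.instance Definition _ := Vector.on tens.

Definition ptens (w : 'I_n -> 'cV[F]_2) : tens :=
  [ffun b : {ffun 'I_n -> 'I_2} => \prod_i w i (b i) 0].

Definition set_index (b : {ffun 'I_n -> 'I_2}) i k : {ffun 'I_n -> 'I_2} :=
  [ffun j => if j == i then k else b j].

Definition site_fun i (x : 'M[F]_2) (v : tens) : tens :=
  [ffun b : {ffun 'I_n -> 'I_2} => \sum_k x (b i) k * v (set_index b i k)].

Fact site_fun_linear i x : linear (site_fun i x).
Proof.
move=> a u v; apply/ffunP=> b; rewrite !ffunE scaler_sumr -big_split /=.
by apply: eq_bigr => k _; rewrite !ffunE mulrDr scalerAr.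
Qed.

HB.instance Definition _ i x :=
  GRing.isLinear.Build F tens tens _ (site_fun i x) (site_fun_linear i x).

Definition site i x : 'End(tens) := linfun (site_fun i x).

Lemma site_ptens i x w :
  site i x (ptens w) = ptens (fun j => if j == i then x *m w i else w j).
Proof.
rewrite lfunE /=; apply/ffunP=> b; rewrite !ffunE.
rewrite [RHS](bigD1 i) //= eqxx mxE big_distrl /=; apply: eq_bigr => k _.
rewrite !ffunE (bigD1 i) //= !ffunE eqxx -mulrA; congr (_ * (_ * _)).
by apply: eq_bigr => j /negPf ji; rewrite !ffunE ji.
Qed.

Definition total x : 'End(tens) := \sum_(i < n) site i x.

Definition Sing : {vspace tens} :=
  (passmx.leigenspace (total sl2_h) (n%:R - 2) :&: lker (total sl2_e))%VS.

Definition site2 i j x y : 'End(tens) := (site i x \o site j y)%VF.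

Definition Omega i j : 'End(tens) :=
  site2 i j sl2_e sl2_f + site2 i j sl2_f sl2_e
  + 2^-1 *: site2 i j sl2_h sl2_h.

Lemma set_indexK b i k l : set_index (set_index b i k) i l = set_index b i l.
Proof. by apply/ffunP=> j; rewrite !ffunE; case: (j == i). Qed.

Lemma set_indexC b i j k l : i != j ->
  set_index (set_index b i k) j l = set_index (set_index b j l) i k.
Proof.
move=> ij; apply/ffunP=> m; rewrite !ffunE.
by case: (eqVneq m j) => [->|//]; rewrite eq_sym (negPf ij).
Qed.

Lemma site_mul i x y : (site i x \o site i y)%VF = site i (x *m y).
Proof.
apply/lfunP=> u; rewrite comp_lfunE !lfunE /=; apply/ffunP=> b; rewrite !ffunE.
transitivity (\sum_k \sum_l x (b i) k * (y k l * u (set_index b i l))).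
  apply: eq_bigr => k _; rewrite !ffunE mulr_sumr eqxx; apply: eq_bigr => l _.
  by rewrite set_indexK.
rewrite exchange_big /=; apply: eq_bigr => l _; rewrite mxE mulr_suml.
by apply: eq_bigr => k _; rewrite mulrA.
Qed.

Lemma site_comm i j x y :
  i != j -> (site i x \o site j y)%VF = (site j y \o site i x)%VF.
Proof.
move=> ij; apply/lfunP=> u; rewrite !comp_lfunE !lfunE /=.
apply/ffunP=> b; rewrite !ffunE.
under eq_bigr => k _ do rewrite !ffunE mulr_sumr eq_sym (negPf ij).
under [RHS]eq_bigr => k _ do rewrite !ffunE mulr_sumr (negPf ij).
rewrite exchange_big /=; apply: eq_bigr => l _; apply: eq_bigr => k _.
by rewrite mulrCA set_indexC.
Qed.

Lemma site_linear i : linear (site i).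
Proof.
move=> a x y; apply/lfunP=> u; rewrite add_lfunE scale_lfunE !lfunE /=.
apply/ffunP=> b; rewrite !ffunE scaler_sumr -big_split /=.
by apply: eq_bigr => k _; rewrite !mxE mulrDl scalerAl.
Qed.

HB.instance Definition _ i :=
  GRing.isLinear.Build F 'M[F]_2 'End(tens) _ (site i) (site_linear i).

Fact total_site2_comp x X Y s l : s != l ->
  (total x \o (site s X \o site l Y))%VF =
  ((site s X \o site l Y) \o total x)%VF
  + (site s (x *m X - X *m x) \o site l Y)%VF
  + (site s X \o site l (x *m Y - Y *m x))%VF.
Proof.
move=> sl; have ls : l != s by rewrite eq_sym.
rewrite /total (bigD1 s) //= (bigD1 l) //=; set S := \sum_(i | _) _.
have SC : (S \o (site s X \o site l Y))%VF = ((site s X \o site l Y) \o S)%VF.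
  rewrite /S; elim/big_rec: _ => [|i u /andP[iS il] IH].
    by rewrite comp_lfun0l comp_lfun0r.
  rewrite comp_lfunDl comp_lfunDr IH; congr (_ + _).
  by rewrite comp_lfunA (site_comm _ _ iS) -comp_lfunA (site_comm _ _ il) comp_lfunA.
rewrite !comp_lfunDl !comp_lfunDr SC !linearB /= !comp_lfunDl !comp_lfunDr.
have -> : (site s x \o (site s X \o site l Y))%VF
          = (site s (x *m X) \o site l Y)%VF by rewrite comp_lfunA site_mul.
have -> : (site l x \o (site s X \o site l Y))%VF
          = (site s X \o site l (x *m Y))%VF.
  by rewrite comp_lfunA (site_comm _ _ ls) -comp_lfunA site_mul.
have -> : ((site s X \o site l Y) \o site s x)%VF
          = (site s (X *m x) \o site l Y)%VF.
  by rewrite -comp_lfunA (site_comm _ _ ls) comp_lfunA site_mul.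
have -> : ((site s X \o site l Y) \o site l x)%VF
          = (site s X \o site l (Y *m x))%VF by rewrite -comp_lfunA site_mul.
rewrite !comp_lfunNl !comp_lfunNr.
set a := (site s (x *m X) \o _)%VF; set b := (site s (X *m x) \o _)%VF.
set c := (_ \o site l (x *m Y))%VF; set d := (_ \o site l (Y *m x))%VF.
set e := (_ \o S)%VF.
have -> : b + (d + e) + (a - b) = d + e + a by rewrite addrC addrA subrK addrC.
by rewrite [RHS]addrC -[d + e + a]addrA [RHS]addrA subrK [LHS]addrCA [a + e]addrC.
Qed.

Lemma sl2_ef : sl2_e *m sl2_f - sl2_f *m sl2_e = sl2_h.
Proof. by rewrite !mul_delta_mx_cond. Qed.

Lemma sl2_he : sl2_h *m sl2_e - sl2_e *m sl2_h = 2 *: sl2_e.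
Proof.
rewrite mulmxBl mulmxBr !mul_delta_mx_cond /= !mulr0n subr0 sub0r opprK.
by rewrite scaler_nat.
Qed.

Lemma sl2_hf : sl2_h *m sl2_f - sl2_f *m sl2_h = - 2 *: sl2_f.
Proof.
rewrite mulmxBl mulmxBr !mul_delta_mx_cond /= !mulr0n subr0 sub0r.
by rewrite scaleNr scaler_nat mulr2n opprD.
Qed.

Lemma total_site2 x X Y s l u : s != l ->
  total x (site2 s l X Y u) =
  site2 s l X Y (total x u) + site2 s l (x *m X - X *m x) Y u
  + site2 s l X (x *m Y - Y *m x) u.
Proof.
move=> sl; have /lfunP/(_ u) := total_site2_comp x X Y sl.
by rewrite comp_lfunE => ->; rewrite !add_lfunE comp_lfunE.
Qed.

Lemma site2Zl i j a x y u : site2 i j (a *: x) y u = a *: site2 i j x y u.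
Proof. by rewrite /site2 !comp_lfunE linearZ /= scale_lfunE. Qed.

Lemma site2Zr i j a x y u : site2 i j x (a *: y) u = a *: site2 i j x y u.
Proof. by rewrite /site2 !comp_lfunE linearZ /= scale_lfunE linearZ. Qed.

Lemma Omega_total_h s l u : s != l ->
  total sl2_h (Omega s l u) = Omega s l (total sl2_h u).
Proof.
move=> sl; rewrite /Omega !add_lfunE !scale_lfunE !(linearD (total _)).
rewrite (linearZZ (total _)) /= !total_site2 // sl2_he sl2_hf subrr.
rewrite -(scale0r sl2_h) !site2Zl !site2Zr !scale0r !addr0 !scaleNr.
by rewrite addrK addrNK.
Qed.

Lemma Omega_total_e s l u : 2 != 0 :> F -> s != l ->
  total sl2_e (Omega s l u) = Omega s l (total sl2_e u).
Proof.
move=> F2 sl; rewrite /Omega !add_lfunE !scale_lfunE !(linearD (total _)).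
rewrite (linearZZ (total _)) /= !total_site2 //.
have -> : sl2_e *m sl2_h - sl2_h *m sl2_e = - 2 *: sl2_e.
  by rewrite -opprB sl2_he scaleNr.
rewrite sl2_ef subrr.
rewrite -(scale0r sl2_h).
rewrite !site2Zl !site2Zr !scale0r !addr0 !scalerDr !scalerA.
rewrite mulrN mulVf // !scaleN1r.
rewrite -[_ - _ - _]addrA -opprD [X in X + _ = _]addrACA.
by rewrite -[LHS]addrA [_ + (_ - _)]addrC subrK.
Qed.

Variable z : 'I_n -> F.

Definition gaudinH s : 'End(tens) :=
  \sum_(l < n | l != s) (z s - z l)^-1 *: Omega s l.

Lemma mem_Sing u :
  (u \in Sing) = (total sl2_h u == (n%:R - 2) *: u) && (total sl2_e u == 0).
Proof.
rewrite memv_cap !memv_ker add_lfunE opp_lfunE scale_lfunE id_lfunE.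
by rewrite subr_eq0.
Qed.

Lemma gaudinH_total s x u :
  (forall l, s != l -> total x (Omega s l u) = Omega s l (total x u)) ->
  total x (gaudinH s u) = gaudinH s (total x u).
Proof.
move=> xO; have HE v : gaudinH s v =
    \sum_(l < n | l != s) (z s - z l)^-1 *: Omega s l v.
  by rewrite sum_lfunE; apply: eq_bigr => l _; rewrite scale_lfunE.
rewrite !HE linear_sum; apply: eq_bigr => l ls.
by rewrite linearZZ /= -xO // eq_sym.
Qed.

Lemma gaudinH_Sing s u : 2 != 0 :> F -> u \in Sing -> gaudinH s u \in Sing.
Proof.
move=> F2; rewrite !mem_Sing => /andP[/eqP hu /eqP eu].
rewrite (gaudinH_total (fun l sl => Omega_total_h u sl)) hu linearZZ eqxx /=.
by rewrite (gaudinH_total (fun l sl => Omega_total_e u F2 sl)) eu linear0.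
Qed.

(* When 2 != 0 in F, vsproj is applied to vectors of Sing only: see gaudinH_Sing. *)
Definition gaudinH_res s : 'End(subvs_of Sing) :=
  (linfun (vsproj Sing) \o gaudinH s \o linfun vsval)%VF.

Lemma gaudinH_resE s u : 2 != 0 :> F -> vsval (gaudinH_res s u) = gaudinH s (vsval u).
Proof.
move=> F2; rewrite !comp_lfunE !lfunE /= vsprojK //.
by apply: gaudinH_Sing => //; apply: subvsP.
Qed.

Definition End_subalg (S : 'End(subvs_of Sing) -> Prop) :=
  [/\ S \1%VF, forall (a : F) f g, S f -> S g -> S (a *: f + g)
         & forall f g, S f -> S g -> S (f \o g)%VF].

Definition in_bethe : {pred 'End(subvs_of Sing)} := fun f =>
  `[< forall S, End_subalg S -> (forall s, S (gaudinH_res s)) -> S f >].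

Lemma in_betheP : End_subalg (fun f => f \in in_bethe).
Proof.
split=> [|a f g /asboolP Bf /asboolP Bg|f g /asboolP Bf /asboolP Bg];
  apply/asboolP => S sS HS; case: (sS) => S1 SD SM //.
- by apply: SD; [apply: Bf | apply: Bg].
- by apply: SM; [apply: Bf | apply: Bg].
Qed.

Lemma gaudinH_bethe s : gaudinH_res s \in in_bethe.
Proof. by apply/asboolP => S _; apply. Qed.

Fact in_bethe_submod_closed : submod_closed in_bethe.
Proof.
case: in_betheP => B1 BD _; split=> [|a f g Bf Bg]; last exact: BD.
by have := BD (-1) _ _ B1 B1; rewrite scaleN1r addNr.
Qed.

HB.instance Definition _ :=
  GRing.isSubmodClosed.Build F 'End(subvs_of Sing) in_bethe
    in_bethe_submod_closed.

Definition bethe_alg := {f : 'End(subvs_of Sing) | f \in in_bethe}.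

HB.instance Definition _ := SubChoice.on bethe_alg.
HB.instance Definition _ := [SubChoice_isSubZmodule of bethe_alg by <:].
HB.instance Definition _ := [SubZmodule_isSubLmodule of bethe_alg by <:].

Fact bethe_one_subproof : \1%VF \in in_bethe.
Proof. by case: in_betheP. Qed.

Fact bethe_mul_subproof (f g : bethe_alg) : (val f \o val g)%VF \in in_bethe.
Proof. by case: in_betheP => _ _; apply; apply: valP. Qed.

Definition bethe_one : bethe_alg := Sub \1%VF bethe_one_subproof.
Definition bethe_mul (f g : bethe_alg) : bethe_alg :=
  Sub (val f \o val g)%VF (bethe_mul_subproof f g).

Fact bethe_mulA : associative bethe_mul.
Proof. by move=> f g h; apply: val_inj; rewrite /= comp_lfunA. Qed.

Fact bethe_mul1l : left_id bethe_one bethe_mul.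
Proof. by move=> f; apply: val_inj; rewrite /= comp_lfun1l. Qed.

Fact bethe_mul1r : right_id bethe_one bethe_mul.
Proof. by move=> f; apply: val_inj; rewrite /= comp_lfun1r. Qed.

Fact bethe_mulDl : left_distributive bethe_mul +%R.
Proof. by move=> f g h; apply: val_inj; rewrite /= comp_lfunDl. Qed.

Fact bethe_mulDr : right_distributive bethe_mul +%R.
Proof. by move=> f g h; apply: val_inj; rewrite /= comp_lfunDr. Qed.

HB.instance Definition _ :=
  GRing.Zmodule_isPzRing.Build bethe_alg
    bethe_mulA bethe_mul1l bethe_mul1r bethe_mulDl bethe_mulDr.

Lemma bethe_scalerAl a (f g : bethe_alg) : a *: (f * g) = (a *: f) * g.
Proof. by apply: val_inj; rewrite /= comp_lfunZl. Qed.

Lemma bethe_scalerAr a (f g : bethe_alg) : a *: (f * g) = f * (a *: g).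
Proof. by apply: val_inj; rewrite /= comp_lfunZr. Qed.

End Gaudin.

(* Main.v *)
Require Import Defs.
From HB Require Import structures.
From mathcomp Require Import all_boot all_order all_algebra all_field.
From mathcomp Require Import perm boolp mpoly zify ring.

Set Implicit Arguments.
Unset Strict Implicit.
Unset Printing Implicit Defensive.

Import GRing.Theory.
Local Open Scope ring_scope.

(* All three algebras are the quotient of F[t] by P = T'. In A this holds since
   T is coprime to T', so that the t - z_s are already units modulo P. In C the
   relations with r <= n - 2 express the a_r as polynomials in t, and the
   remaining one is the derivative at x = t of Wr(g1, x - t) - (n - 1) T, that
   is - (n - 1) T'(t). The space Sing consists of the vectors
   sum_i c_i f^(i) v_1 (x) ... (x) v_1 with sum_i c_i = 0, and the map
   c |-> sum_i c_i T / (t - z_i) identifies it with F[t] / (P). Up to an additive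
   constant, H_s becomes multiplication by (t - z_s)^-1; these inverses span
   F[t] / (P), whence the Bethe algebra is F[t] / (P) in its regular
   representation. *)

(** * Comparison of two surjections with the same fibres *)

Section Factor.

(** Choosing sections of [f] and of [g] gives two maps, inverse to each other because the fibres
    agree. It serves with [R] = F[t], of which every object to be compared is a quotient. *)
Lemma factor_bij (R X Y : Type) (f : R -> X) (g : R -> Y) :
    (forall x, exists a, f a = x) -> (forall y, exists a, g a = y) ->
    (forall a b, f a = f b <-> g a = g b) ->
  exists2 h : X -> Y, bijective h & forall a, h (f a) = g a.
Proof.
move=> /choice[f' f'K] /choice[g' g'K] fg.
exists (g \o f') => [|a]; last by apply/fg; rewrite f'K.
exists (f \o g') => [x|y] /=.
  by rewrite -[RHS]f'K; apply/fg; rewrite g'K.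
by rewrite -[RHS]g'K; apply/fg; rewrite f'K.
Qed.

Lemma factor_linear (F : fieldType) (R X Y : lmodType F)
    (f : R -> X) (g : R -> Y) (h : X -> Y) :
    (forall x, exists a, f a = x) -> (forall a, h (f a) = g a) ->
  linear f -> linear g -> linear h.
Proof.
move=> fS hf fL gL c x y; have [[a <-] [b <-]] := (fS x, fS y).
by rewrite -fL !hf gL.
Qed.

Lemma factor_monoid_morphism (R X Y : pzRingType)
    (f : R -> X) (g : R -> Y) (h : X -> Y) :
    (forall x, exists a, f a = x) -> (forall a, h (f a) = g a) ->
  monoid_morphism f -> monoid_morphism g -> monoid_morphism h.
Proof.
move=> fS hf [f1 fM] [g1 gM]; split=> [|x y]; first by rewrite -f1 hf.
by have [[a <-] [b <-]] := (fS x, fS y); rewrite -fM !hf gM.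
Qed.

End Factor.

(** The Leibniz rule, by induction on [r]; uniqueness makes the condition [j != i] drop exactly one
    factor. *)
Lemma deriv_prod_uniq (R : comNzRingType) (I : eqType) (r : seq I)
    (f : I -> {poly R}) : uniq r ->
  (\prod_(i <- r) f i)^`() =
  \sum_(i <- r) (f i)^`() * \prod_(j <- r | j != i) f j.
Proof.
elim: r => [_|a r IH /= /andP[ar /IH{}IH]]; first by rewrite !big_nil derivC.
rewrite !big_cons derivM IH eqxx /= mulr_sumr; congr (_ * _ + _).
  rewrite big_seq [RHS]big_seq_cond; apply: eq_bigl => i.
  by case: (eqVneq i a) => [->|_]; rewrite ?andbT // (negPf ar).
apply: eq_big_seq => i ir; rewrite big_cons.
have -> : a != i by apply: contraNneq ar => ->.
exact: mulrCA.
Qed.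

(** * Lagrange interpolation at the points [z], and the polynomial T' *)

Section Points.

Variables (F : fieldType) (n : nat) (z : 'I_n -> F).
Hypothesis z_inj : injective z.

Let T : {poly F} := \prod_(s < n) ('X - (z s)%:P).

(** This is T / (t - z_s), a Lagrange basis polynomial up to a scalar. *)
Definition cofac s : {poly F} := \prod_(l < n | l != s) ('X - (z l)%:P).

Definition sum_cofac : {poly F} := \sum_(s < n) cofac s.

Lemma sum_cofacE : sum_cofac = \sum_(s < n) 1 *: cofac s.
Proof. by apply: eq_bigr => s _; rewrite scale1r. Qed.

Lemma cofacE s : T = ('X - (z s)%:P) * cofac s.
Proof. by rewrite /T (bigD1 s). Qed.

Lemma deriv_prod_XsubC : T^`() = sum_cofac.
Proof.
rewrite deriv_prod_uniq ?index_enum_uniq //; apply: eq_bigr => s _.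
by rewrite derivXsubC mul1r.
Qed.

Lemma size_cofac s : size (cofac s) = n.
Proof.
rewrite /cofac -big_filter size_prod_XsubC; have := cardC1 s.
rewrite card_ord cardE /enum_mem /= => ->; case: n s => [[]|] //.
Qed.

Lemma monic_cofac s : cofac s \is monic.
Proof. exact: monic_prod_XsubC. Qed.

(** The two cofactors differ in a single linear factor, so that factoring out the common part leaves
    a constant. *)
Lemma cofac_XsubC s l : l != s ->
  cofac l - cofac s = (z l - z s)%:P * \prod_(i < n | (i != l) && (i != s)) ('X -
    (z i)%:P).
Proof.
move=> ls; rewrite /cofac (bigD1 s) 1?eq_sym //= [in X in _ - X](bigD1 l) //=.
under [in X in _ - X]eq_bigl => i do rewrite andbC.
by rewrite -mulrBl polyCB; congr (_ * _); rewrite opprB addrC subrKA.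
Qed.

Lemma horner_cofac_neq s l : l != s -> (cofac s).[z l] = 0.
Proof.
by move=> ls; rewrite /cofac (bigD1 l) //= hornerM hornerXsubC subrr mul0r.
Qed.

Lemma horner_cofac_neq0 s : (cofac s).[z s] != 0.
Proof.
rewrite horner_prod; apply/prodf_neq0 => l ls.
by rewrite hornerXsubC subr_eq0 inj_eq // eq_sym.
Qed.

Lemma horner_sum_cofac (c : 'I_n -> F) s :
  (\sum_(l < n) c l *: cofac l).[z s] = c s * (cofac s).[z s].
Proof.
rewrite horner_sum (bigD1 s) //= hornerZ big1 ?addr0 // => l ls.
by rewrite hornerZ horner_cofac_neq 1?eq_sym // mulr0.
Qed.

Lemma size_sum_cofac (c : 'I_n -> F) :
  (size (\sum_(l < n) c l *: cofac l)%R <= n)%N.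
Proof.
apply: (leq_trans (size_sum _ _ _)); apply/bigmax_leqP => l _.
by rewrite (leq_trans (size_scale_leq _ _)) // size_cofac.
Qed.

Lemma poly_eq_at_points (q r : {poly F}) : (size q <= n)%N -> (size r <= n)%N ->
  (forall s, q.[z s] = r.[z s]) -> q = r.
Proof.
move=> qn rn qr; apply/eqP; rewrite -subr_eq0; apply/eqP.
apply: (@roots_geq_poly_eq0 _ _ (map z (enum 'I_n))).
- by apply/allP => _ /mapP[s _ ->]; rewrite rootE !hornerE qr subrr.
- by rewrite map_inj_uniq ?enum_uniq.
- rewrite size_map size_enum_ord (leq_trans (size_polyD _ _)) //.
  by rewrite size_polyN geq_max qn rn.
Qed.

(** Lagrange interpolation: both sides have degree less than [n] and agree at the [n] distinct
    points. *)
Lemma cofac_span (q : {poly F}) : (size q <= n)%N ->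
  q = \sum_(s < n) (q.[z s] / (cofac s).[z s]) *: cofac s.
Proof.
move=> qn; apply: poly_eq_at_points => // [|s]; first exact: size_sum_cofac.
by rewrite horner_sum_cofac divfK ?horner_cofac_neq0.
Qed.

Lemma cofac_free (c d : 'I_n -> F) :
  \sum_(s < n) c s *: cofac s = \sum_(s < n) d s *: cofac s -> c =1 d.
Proof.
move=> cd s; apply: (mulIf (horner_cofac_neq0 s)).
by rewrite -!horner_sum_cofac cd.
Qed.

(** At z_s only the summand [cofac z s] survives, and it does not vanish there: the roots of T are
    simple. *)
Lemma coprime_XsubC_sum_cofac s : coprimep sum_cofac ('X - (z s)%:P).
Proof.
rewrite coprimep_XsubC rootE.
by rewrite sum_cofacE horner_sum_cofac mul1r horner_cofac_neq0.
Qed.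

Lemma coprime_prod_sum_cofac : coprimep sum_cofac T.
Proof.
rewrite /T; elim/big_ind: _ => [|p q cp cq|s _]; first exact: coprimep1.
  by rewrite coprimepMr cp cq.
exact: coprime_XsubC_sum_cofac.
Qed.

Hypothesis n_neq0 : n%:R != 0 :> F.

Lemma size_sum_cofacs : size sum_cofac = n.
Proof.
apply/eqP; rewrite eqn_leq; apply/andP; split.
  by rewrite sum_cofacE size_sum_cofac.
have n_gt0 : (0 < n)%N by case: n n_neq0 => //; rewrite eqxx.
(* The [n] cofactors are monic of degree n - 1, so the coefficient in this degree is [n]. *)
rewrite -(prednK n_gt0) ltnNge; apply: contra n_neq0 => /leq_sizeP/(_ _ (leqnn _)).
rewrite coef_sum => /eqP; congr (_ == 0).
rewrite (eq_bigr (fun=> 1)) ?sumr_const ?card_ord // => s _.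
by have /monicP := monic_cofac s; rewrite lead_coefE size_cofac.
Qed.

End Points.

(** * Evaluation of F[t] into a quotient algebra *)

Section QuotientFacts.

Variables (F : fieldType) (A : comAlgType F) (gens : seq A) (a : A).

Definition quot_horner (q : {poly F}) : quot_alg gens := quot_pi gens (horner_alg a q).

Lemma quot_horner_linear : linear quot_horner.
Proof. by move=> c p q; rewrite /quot_horner linearP /= mulr_algl;
  apply: quot_pi_linear. Qed.

Lemma quot_horner_monoid_morphism : monoid_morphism quot_horner.
Proof.
have [pi1 piM] := quot_pi_monoid_morphism gens.
by split=> [|p q]; rewrite /quot_horner ?rmorph1 ?rmorphM /= ?piM.
Qed.

Lemma quot_pi_eq0 x : quot_pi gens x = 0 <-> x \in gen_ideal gens.
Proof.
rewrite -[x in x \in _]subr0.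
have -> : (0 : quot_alg gens) = quot_pi gens 0 by rewrite raddf0.
by split=> /quot_piP.
Qed.

Lemma mem_gen_ideal x : x \in gens -> x \in gen_ideal gens.
Proof.
rewrite -index_mem => xg; apply/asboolP.
exists (fun i => (i == Ordinal xg)%:R); rewrite (bigD1 (Ordinal xg)) //= eqxx.
rewrite mul1r big1 ?addr0 => [|i /negPf->]; last by rewrite mul0r.
by rewrite nth_index // -index_mem.
Qed.

Lemma horner_fibre (d p q : {poly F}) :
    (forall r, quot_horner r = 0 <-> d %| r) ->
  quot_horner p = quot_horner q <-> d %| p - q.
Proof.
move=> <-; have -> : quot_horner (p - q) = quot_horner p - quot_horner q.
  by have := quot_horner_linear (- 1) q p; rewrite !scaleN1r ![- _ + _]addrC.
by split=> [->|/eqP]; rewrite ?subrr // subr_eq0 => /eqP.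
Qed.

End QuotientFacts.

(** The induction principle hidden in the definition by intersection, for a predicate in [Prop]. *)
Lemma gen_subalg_ind (F : fieldType) (A : comAlgType F) (gens : seq A) (S : A -> Prop) :
    S 1 -> (forall a x y, S x -> S y -> S (a *: x + y)) ->
    (forall x y, S x -> S y -> S (x * y)) -> (forall x, x \in gens -> S x) ->
  forall x, x \in gen_subalg gens -> S x.
Proof.
move=> S1 SD SM Sg x /asboolP gx; apply/asboolP.
apply: (gx (fun y => `[< S y >])) => [|y /Sg Sy]; last exact/asboolP.
by split=> [|a u v|u v]; [|move=> /asboolP Su /asboolP Sv..]; apply/asboolP => //;
  [apply: SD | apply: SM].
Qed.

(** * The algebra A *)

Section AlgebraA.

Variables (F : fieldType) (n : nat) (z : 'I_n -> F).
Hypothesis z_inj : injective z.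

Let T : {poly F} := \prod_(s < n) ('X - (z s)%:P).
Let P := sum_cofac z.

Lemma val_horner_OU q : val (horner_alg (OU_t z) q) = ratfun_poly q.
Proof.
elim/poly_ind: q => [|q c IH]; first by rewrite !raddf0 /ratfun_poly rmorph0.
rewrite !rmorphD !rmorphM /= IH horner_algX horner_algC /ratfun_poly rmorphD rmorphM.
congr (_ + _); rewrite -[LHS]/(val (c *: (1 : OU z))) linearZ rmorph1 /=.
exact: mulr1.
Qed.

Lemma horner_OU_P : horner_alg (OU_t z) P = OU_P z.
Proof.
rewrite rmorph_sum; apply: eq_bigr => s _; rewrite rmorph_prod; apply: eq_bigr => l _.
by rewrite rmorphB /= horner_algX horner_algC.
Qed.

Lemma ratfun_prod : \prod_(s < n) ratfun_poly ('X - (z s)%:P) = ratfun_poly T.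
Proof. by rewrite /ratfun_poly rmorph_prod. Qed.

Lemma ratfun_T_neq0 : ratfun_poly T != 0.
Proof. by rewrite tofrac_eq0 monic_neq0 // monic_prod_XsubC. Qed.

(** Induction on the generation of O(U): its only generator that is not a polynomial is 1/T, and
    exponents add up under sums and products. *)
Lemma OU_denom (x : OU z) : exists k q, ratfun_poly T ^+ k * val x = ratfun_poly q.
Proof.
elim/gen_subalg_ind: (val x) / (valP x) => [|a u v [k [q uq]] [l [r vr]]|u v [k [q
  uq]] [l [r vr]]|y].
- by exists 0%N, 1; rewrite mulr1 expr0 /ratfun_poly rmorph1.
- exists (k + l)%N, (a *: (T ^+ l * q) + T ^+ k * r).
  rewrite -[a *: (_ * _)]mul_polyC /ratfun_poly rmorphD !rmorphM !rmorphXn /=.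
  rewrite -[tofrac q]uq -[tofrac r]vr exprD mulrDr; congr (_ + _).
    rewrite [LHS]mulrCA; congr (_ * _).
    by rewrite -mulrA [LHS]mulrCA.
  by rewrite !mulrA.
- exists (k + l)%N, (q * r).
  by rewrite /ratfun_poly rmorphM /= -[tofrac q]uq -[tofrac r]vr exprD mulrACA.
rewrite !inE => /orP[]/eqP->.
  by exists 0%N, 'X; rewrite expr0 mul1r.
exists 1%N, 1; rewrite ratfun_prod expr1 divff ?ratfun_T_neq0 //.
Qed.

(** If q is a multiple of P in O(U), clearing denominators shows that P divides T^k q, and T is
    coprime to P. *)
Lemma quot_horner_OU_eq0 q : quot_horner [:: OU_P z] (OU_t z) q = 0 <-> P %| q.
Proof.
rewrite /quot_horner quot_pi_eq0; split=> [/asboolP[c]|/dvdpP[r ->]].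
  rewrite big_ord1 /= -horner_OU_P => /(congr1 val); rewrite val_horner_OU.
  have [k [y cy]] := OU_denom (c ord0) => /(congr1 (fun x => ratfun_poly T ^+ k * x)).
  rewrite /= mulrA cy val_horner_OU /ratfun_poly -rmorphXn -!rmorphM.
  move/eqP; rewrite tofrac_eq => /eqP Tq;
    have : P %| T ^+ k * q by rewrite Tq dvdp_mull.
  by rewrite Gauss_dvdpr // coprimep_expr // coprime_prod_sum_cofac.
by rewrite rmorphM /= horner_OU_P gen_idealMl // mem_gen_ideal // mem_head.
Qed.

(** It suffices to reach the generators; 1/T is the image of a polynomial inverse of T modulo P. *)
Lemma quot_horner_OU_surj x : exists q, quot_horner [:: OU_P z] (OU_t z) q = x.
Proof.
pose pi := quot_pi [:: OU_P z]; pose h := quot_horner [:: OU_P z] (OU_t z).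
have hL : linear h := @quot_horner_linear _ _ _ _.
have [h1 hM] : monoid_morphism h := @quot_horner_monoid_morphism _ _ _ _.
have piL : linear pi := @quot_pi_linear _ _ _.
have [pi1 piM] : monoid_morphism pi := @quot_pi_monoid_morphism _ _ _.
(* The induction runs over values in the field of fractions, so the element of O(U) above each value
   is carried along existentially. *)
suff [y [yx [q hq]]] : exists y : OU z, val y = val (repr x) /\ exists q, h q = pi y.
  by exists q; rewrite -[x]quot_reprK -(val_inj yx).
elim/gen_subalg_ind: (val (repr x)) / (valP (repr x))
    => {x} [|a _ _ [x [<- [p px]]] [y [<- [q qy]]]|_ _ [x [<- [p px]]] [y [<- [q
      qy]]]|x].
- by exists 1; rewrite rmorph1; split=> //; exists 1; rewrite h1 pi1.
- by exists (a *: x + y); rewrite linearP; split=> //; exists (a *: p + q);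
  rewrite hL px qy piL.
- by exists (x * y); rewrite rmorphM; split=> //; exists (p * q); rewrite hM px qy piM.
move=> xg; exists (Sub x (mem_gen_subalg xg)); rewrite SubK; split=> //.
move: (mem_gen_subalg xg) => xG; move: xg; rewrite !inE => /orP[]/eqP xE.
  exists 'X; rewrite /h /quot_horner horner_algX; congr (pi _); apply: val_inj.
  by rewrite /= xE.
have /Bezout_eq1_coprimepP[[r s]/= rs] : coprimep T P by rewrite coprimep_sym
  coprime_prod_sum_cofac.
exists r; set y := Sub x xG.
(* Multiplying [r T + s P = 1] by [T^-1]. *)
suff -> : y = horner_alg (OU_t z) r + y * horner_alg (OU_t z) s * OU_P z.
  rewrite /pi raddfD /= (_ : quot_pi _ (_ * OU_P z) = 0) ?addr0 //.
  by apply/quot_pi_eq0; rewrite gen_idealMl // mem_gen_ideal // mem_head.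
apply: val_inj; rewrite rmorphD !rmorphM /= -horner_OU_P !val_horner_OU -mulrA.
have -> : ratfun_poly s * ratfun_poly P = 1 - ratfun_poly r * ratfun_poly T.
  by apply/esym/eqP; rewrite subr_eq addrC /ratfun_poly -!rmorphM -rmorphD rs rmorph1.
rewrite xE ratfun_prod mulrBr mulr1 mulrCA mulVf ?ratfun_T_neq0 //.
by rewrite mulr1 addrC subrK.
Qed.

End AlgebraA.

(** * The algebra C *)

Section AlgebraC.

Variables (F : fieldType) (n : nat) (T : {poly F}).
Hypothesis n_ge2 : (2 <= n)%N.
Hypothesis T_monic : T \is monic.
Hypothesis T_size : size T = n.+1.
Hypothesis charF : forall k, (0 < k <= n)%N -> k%:R != 0 :> F.

Let N := n.-2.+2.
Let R := {mpoly F[N]}.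
Let t : R := C_t F n.
Let g : {poly R} := g1 F n.
Let b : R := n%:R - 1.

Lemma NE : N = n.
Proof. by rewrite /N; case: n n_ge2 => [|[]]. Qed.

(** Since a_(n-1) is absent from g1, the case k = 1 falls into the last branch and gives 0, as [n]
    is at least 2. *)
Lemma coef_g1 k : g`_k = if (k == 0)%N then C_an F n else
  if (1 < k < n)%N then C_a F n (n - k) else (k == n)%:R.
Proof.
rewrite /g /g1 !coefD coefXn coefC coef_sum.
case: k => [|k] /=.
  rewrite big_nat_cond big1 => [|r]; last first.
    rewrite andbT => /andP[_ rn]; rewrite coefZ coefXn.
    by case: (n - r)%N (subn_gt0 r n) => [|m];
      rewrite ?mulr0 // (leq_trans rn) ?leq_pred.
  by rewrite ltn_eqF ?add0r // (leq_trans _ n_ge2).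
rewrite addr0; case: ifPn => [/andP[k1 kn]|kn]; last first.
  rewrite big_nat_cond big1 ?addr0 // => r; rewrite andbT => /andP[r0 rn].
  rewrite coefZ coefXn; case: eqVneq; rewrite ?mulr0 // => kE.
  by case/negP: kn; rewrite kE; apply/andP; split; lia.
rewrite (ltn_eqF kn) add0r (bigD1_seq (n - k.+1)%N) ?iota_uniq //=; last first.
  by rewrite mem_index_iota; lia.
rewrite coefZ coefXn subKn ?(ltnW kn) // eqxx mulr1 big_nat_cond big1 ?addr0 // => r.
by case/andP=> rn rk; rewrite coefZ coefXn; case: eqVneq; rewrite ?mulr0 //; lia.
Qed.

Lemma coef_C_rel k : (C_rel n T)`_k =
  g`_k *+ k - t * (g`_k.+1 *+ k.+1) - g`_k - b * (T`_k)%:MP.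
Proof.
rewrite /C_rel coefB coefZ coef_map /= /Wr coefB derivXsubC mulr1 mulrBr coefB.
by rewrite coefMX coefMC !coef_deriv [t * _]mulrC; case: k => //=; rewrite mulr0n.
Qed.

(* The Wronskian with the linear polynomial [x - t] has derivative
   [g1'' (x - t)], which vanishes at [t]. *)
Lemma deriv_C_rel : (C_rel n T)^`().[t] = (1 - n%:R) *: horner_alg t T^`().
Proof.
rewrite /C_rel derivB derivZ hornerD hornerN hornerZ /Wr derivB !derivM derivXsubC
  derivC.
rewrite mulr1 mulr0 addr0 addrK hornerM hornerXsubC subrr mulr0 sub0r -mulNr.
rewrite -mulr_algl scalerBl scaler_nat scale1r opprB.
congr (_ * _); rewrite deriv_map /horner_alg /horner_morph; congr (_.[_]).
by apply: eq_map_poly => c; rewrite /= -mul_mpolyC mulr1.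
Qed.

Lemma b_neq0 : n%:R - 1 != 0 :> F.
Proof.
have n_gt0 : (0 < n)%N by apply: leq_trans n_ge2.
by rewrite -(natrB _ n_gt0) charF //; lia.
Qed.

Let pi : R -> wronski_alg n T := quot_pi (C_rel n T).
Let h : {poly F} -> wronski_alg n T := quot_horner (C_rel n T) t.

Lemma C_rel_ideal k : (C_rel n T)`_k \in gen_ideal (C_rel n T).
Proof.
case: (ltnP k (size (C_rel n T))) => kn; last by rewrite nth_default ?rpred0.
exact/mem_gen_ideal/mem_nth.
Qed.

(** The derivative of [C_rel n T] at [t] is a combination of the relations; it equals (1 - n) T'(t),
    and 1 - n is invertible. *)
Lemma quot_horner_C_deriv : h T^`() = 0.
Proof.
apply/quot_pi_eq0.
suff : (C_rel n T)^`().[t] \in gen_ideal (C_rel n T).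
  rewrite deriv_C_rel => /(gen_idealMl (1 - n%:R)^-1%:A).
  by rewrite mulr_algl scalerA mulVf ?scale1r // -opprB oppr_eq0 b_neq0.
rewrite horner_coef rpred_sum // => i _; rewrite coef_deriv mulrC gen_idealMl //.
by rewrite rpredMn // C_rel_ideal.
Qed.

(* Solves the relations for [r <= n - 2] recursively for [a_r] in terms of [t]. *)
Fixpoint wcoef r : {poly F} :=
  if r is r'.+1 then
    (n - r - 1)%:R^-1 *:
      ((n - r')%:R *: ('X * wcoef r') + (n%:R - 1) *: (T`_(n - r))%:P)
  else 1.

(** The value at [ord_max] is that of a_n, forced by the relation in degree 0. *)
Definition wpoint (i : 'I_N) : {poly F} :=
  if i == ord0 then 'X
  else if i == ord_max then ((1 - n%:R) * T`_0)%:P else wcoef i.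

(** Substitution of the solved values for the variables: a left inverse of [horner_alg t] that kills
    every relation except the one in degree 1. *)
Let ev : R -> {poly F} := mmap polyC wpoint.

Lemma ev_t : ev t = 'X.
Proof. by rewrite /ev /t /C_t mmapX mmap1U. Qed.

Lemma ev_an : ev (C_an F n) = ((1 - n%:R) * T`_0)%:P.
Proof. by rewrite /ev mmapX mmap1U /wpoint -!(inj_eq val_inj) /= eqxx. Qed.

Lemma ev_a r : (0 < r < n.-1)%N -> ev (C_a F n r) = wcoef r.
Proof.
move=> /andP[r0 rn]; rewrite /ev mmapX mmap1U /wpoint.
have rN : (inord r : 'I_N) = r :> nat by rewrite inordK // /N; lia.
rewrite -!(inj_eq val_inj) /= rN ifF; last by lia.
by rewrite ifF //; lia.
Qed.

Lemma ev_g1 k : (1 < k <= n)%N -> ev g`_k = wcoef (n - k).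
Proof.
rewrite coef_g1 => kn; rewrite ifF; last by lia.
case: ifPn => kn'; first by rewrite ev_a //; lia.
have -> : k = n by lia.
by rewrite eqxx subnn /ev rmorph1.
Qed.

Lemma ev_C_relE k : ev (C_rel n T)`_k =
  ev g`_k *+ k - 'X * (ev g`_k.+1 *+ k.+1) - ev g`_k - (n%:R - 1) *: (T`_k)%:P.
Proof.
rewrite coef_C_rel -ev_t /ev !rmorphB !rmorphM !rmorphMn /= mmapC.
by rewrite rmorphB rmorph1 rmorph_nat -[in RHS]mulr_algl scalerBl scaler_nat scale1r.
Qed.

(** Degree 0 is solved by a_n, a degree k with 1 < k < n by the recursion for a_(n-k); in degree n
    the leading terms cancel. In degree 1 nothing can be solved, since a_(n-1) would have
    coefficient 0. *)
Lemma ev_C_rel k : k != 1%N -> ev (C_rel n T)`_k = 0.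
Proof.
move=> k1; rewrite ev_C_relE.
have Tn : T`_n = 1 by have /monicP := T_monic; rewrite lead_coefE T_size.
case: (ltngtP k 1) k1 => // [k0|k1] _.
  have -> : k = 0%N by lia.
  rewrite !coef_g1 eqxx /= ev_an (_ : (1 == n)%N = false); last by lia.
  rewrite !mulr0n mulr1n /ev rmorph0 mulr0 subr0 sub0r.
  by rewrite polyCM -mul_polyC -mulNr -mulrBl -polyCN -polyCB opprB subrr mul0r.
case: (ltngtP k n) => [kn|kn|->].
- rewrite !ev_g1; try lia.
  have -> : (n - k = (n - k.+1).+1)%N by lia.
  rewrite /= (_ : n - (n - k.+1).+1 = k)%N; last by lia.
  rewrite (_ : n - (n - k.+1) = k.+1)%N; last by lia.
  (* Here [v] is [wcoef] at n - k, that is [e] divided by k - 1, which is invertible. *)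
  set e := _ *: ('X * _) + _; set v := _ *: e.
  have -> : v *+ k = e + v.
    rewrite (_ : k = (k - 1).+1); last by lia.
    by rewrite mulrSr -[X in X + _]scaler_nat {1}/v scalerA mulfV ?scale1r //
      charF; lia.
  by rewrite [_ - v]addrAC addrK /e scaler_nat mulrnAr addrAC addrK subrr.
- rewrite !coef_g1 !ifF ?gtn_eqF ?ltnS ?(ltnW kn) //=; try lia.
  by rewrite /ev !rmorph0 !mul0rn mulr0 nth_default ?T_size // scaler0 !subr0.
- rewrite !coef_g1 !ifF ?eqxx ?gtn_eqF //=; try lia.
  by rewrite Tn scalerBl scaler_nat scale1r /ev rmorph1 rmorph0 mul0rn mulr0 subr0
    subrr.
Qed.

(** Applying [ev] to an expression of q(t) through the relations leaves q on one side and a multiple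
    of the relation in degree 1 on the other. *)
Lemma quot_horner_C_eq0 q : h q = 0 <-> T^`() %| q.
Proof.
split=> [/quot_pi_eq0/asboolP[c /(congr1 ev)]|/dvdpP[r ->]]; last first.
  have [_ hM] : monoid_morphism h := @quot_horner_monoid_morphism _ _ _ _.
  by rewrite hM quot_horner_C_deriv mulr0.
have evh r : ev (horner_alg t r) = r.
  elim/poly_ind: r => [|r a IH]; rewrite /ev ?raddf0 //.
  by rewrite !rmorphD !rmorphM /= -/ev IH horner_algX horner_algC alg_mpolyC ev_t
    /ev mmapC.
rewrite evh => ->; rewrite /ev rmorph_sum /=; elim/big_ind: _ => [|x y|i _].
- exact: dvdp0.
- exact: dvdp_add.
rewrite rmorphM dvdp_mull //= -/ev.
case: (eqVneq (i : nat) 1%N) => [->|/ev_C_rel->]; last exact: dvdp0.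
have := congr1 ev deriv_C_rel; rewrite -mulr_algl alg_mpolyC.
rewrite {2}/ev rmorphM /= mmapC -/ev evh => evE.
suff -> : ev (C_rel n T)`_1 = ev (C_rel n T)^`().[t] by rewrite evE dvdp_mull.
(* After substitution only the linear term remains, so the derivative is constant and its value at
   [t] gives the coefficient. *)
have relE : map_poly ev (C_rel n T) = ev (C_rel n T)`_1 *: 'X.
  apply/polyP=> k; rewrite coef_map coefZ coefX /=.
  by case: (eqVneq k 1%N) => [->|/ev_C_rel]; rewrite ?mulr1 // mulr0.
have := horner_map (mmap polyC wpoint) (C_rel n T)^`() t.
by rewrite /= -/ev => <-; rewrite -deriv_map relE derivZ derivX hornerZ hornerC mulr1.
Qed.

(** The elements with class in the image of [h] form a subalgebra [S]; the relations place every
    variable in it. *)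
Lemma quot_horner_C_surj x : exists q, h q = x.
Proof.
have hL : linear h := @quot_horner_linear _ _ _ _.
have [h1 hM] : monoid_morphism h := @quot_horner_monoid_morphism _ _ _ _.
have piL : linear pi := @quot_pi_linear _ _ _.
have [pi1 piM] : monoid_morphism pi := @quot_pi_monoid_morphism _ _ _.
rewrite -[x]quot_reprK; move: (repr x) => {x} x.
pose S y := exists q, h q = pi y.
have SD a y y' : S y -> S y' -> S (a *: y + y').
  by move=> [q qy] [q' qy']; exists (a *: q + q'); rewrite hL qy qy' piL.
have SM y y' : S y -> S y' -> S (y * y').
  by move=> [q qy] [q' qy']; exists (q * q'); rewrite hM qy qy' piM.
have S1 : S 1 by exists 1; rewrite h1 pi1.
have S0 : S 0 by have := SD (-1) _ _ S1 S1; rewrite scaleN1r addNr.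
have SZ a y : S y -> S (a *: y) by move=> Sy; rewrite -[_ *: _]addr0; apply: SD.
have SDr y y' : S y -> S y' -> S (y + y') by move=> Sy Sy'; rewrite -[y]scale1r;
  apply: SD.
have St : S t by exists 'X; rewrite /h /quot_horner horner_algX.
have Sb (c : F) : S (b * c%:MP).
  by rewrite mulrC mul_mpolyC; apply/SZ; rewrite /b -scaler_nat -scaleN1r;
    apply: SD => //; apply: SZ.
have Srel k y : S (y - (C_rel n T)`_k) -> S y.
  case=> q qy; exists q; rewrite qy /pi raddfB /=.
  by have /quot_pi_eq0 -> := C_rel_ideal k; rewrite subr0.
(* Descending the degree k = n - m, the relation gives (k - 1) times the coefficient of g1 in terms
   of the previous one and [t]; the bound on [m] keeps k at least 2. *)
have Sg m : (m <= n - 2)%N -> S g`_(n - m).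
  elim: m => [_|m IH mn].
    by rewrite subn0 coef_g1 ltnn andbF eqxx ifF //; lia.
  have {IH} := IH (ltnW mn); have -> : (n - m = (n - m.+1).+1)%N by lia.
  have [k kE] : exists k, (n - m.+1)%N = k by exists (n - m.+1)%N.
  rewrite kE => Sk.
  have k1 : (k - 1)%:R != 0 :> F by apply: charF; lia.
  rewrite -[g`_k]scale1r -(mulVf k1) -scalerA; apply/SZ/(Srel k).
  rewrite coef_C_rel scaler_nat (_ : g`_k *+ k = g`_k *+ (k - 1) + g`_k); last first.
    by rewrite -mulrSr; congr (_ *+ _); lia.
  rewrite [_ - t * _ - _]addrAC addrK !opprB addrCA [_ + (t * _ - _)]addrC subrK.
  by apply: SDr => //; apply: SM; rewrite // -scaler_nat; apply: SZ.
have SX i : S 'X_i.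
  case: (eqVneq i ord0) => [->//|i0]; case: (eqVneq i ord_max) => [->|im].
    rewrite -[X in S X]opprK -scaleN1r; apply/SZ/(Srel 0%N).
    rewrite coef_C_rel !coef_g1 /= (_ : (1 == n)%N = false); last by lia.
    by rewrite !mulr0n mulr1n mulr0 subr0 sub0r opprB addrC subrK; apply: Sb.
  case: i i0 im => j jN; rewrite -!(inj_eq val_inj) /= => j0 jm.
  have -> : Ordinal jN = inord j by apply: val_inj; rewrite /= inordK.
  have jn : (j < n)%N by rewrite -NE.
  have := Sg j; rewrite coef_g1 subKn ?(ltnW jn) // ifF; last by lia.
  by rewrite ifT; [apply|]; lia.
rewrite [x]mpolyE; apply: (@big_ind _ S) => // m _; apply: SZ.
rewrite mpolyXE_id; apply: (@big_ind _ S) => // i _.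
by elim: (m i) => [|k IH]; rewrite ?expr0 // exprS; apply: SM.
Qed.

End AlgebraC.

(** * The Gaudin model on Sing *)

Section Tensors.

Variables (F : fieldType) (n : nat).
Hypothesis F2 : 2 != 0 :> F.

Implicit Types (u : tens F n) (b : {ffun 'I_n -> 'I_2}).

Lemma ord2P (k : 'I_2) : k = 0 \/ k = 1.
Proof. by case: k => [[|[|k]] ik] //; [left | right]; apply: val_inj. Qed.

Lemma siteE i x u b : site i x u b = \sum_k x (b i) k * u (set_index b i k).
Proof. by rewrite lfunE ffunE. Qed.

Lemma set_index_id b i : set_index b i (b i) = b.
Proof. by apply/ffunP=> j; rewrite ffunE; case: eqP => [->|]. Qed.

Lemma site2E i j x y u b : i != j ->
  site2 i j x y u b = \sum_k \sum_m
    x (b i) k * (y (b j) m * u (set_index (set_index b i k) j m)).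
Proof.
move=> ij; rewrite comp_lfunE siteE; apply: eq_bigr => k _.
by rewrite siteE ffunE eq_sym (negPf ij) mulr_sumr.
Qed.

Definition swap s l b : {ffun 'I_n -> 'I_2} := [ffun j => b (tperm s l j)].

Lemma swapE s l b : s != l -> swap s l b = set_index (set_index b s (b l)) l (b s).
Proof.
move=> sl; apply/ffunP=> j; rewrite !ffunE.
case: tpermP => [->|->|/eqP/negPf-> /eqP/negPf->//]; last by rewrite eqxx.
by rewrite (negPf sl) eqxx.
Qed.

(* On [L_1 (x) L_1] the operator [Omega] is the flip minus [1/2]. *)
Lemma OmegaE s l u b : s != l -> Omega F s l u b = u (swap s l b) - 2^-1 * u b.
Proof.
move=> sl; rewrite swapE //; pose U k m : F := u (set_index (set_index b s k) l m).
have -> : u b = U (b s) (b l) by rewrite /U set_index_id set_index_id.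
rewrite -/(U (b l) (b s)) !add_lfunE scale_lfunE !ffunE !site2E //.
under eq_bigr => k _ do under eq_bigr => m _ do rewrite -/(U k m).
under [X in _ + X + _]eq_bigr => k _ do under eq_bigr => m _ do rewrite -/(U k m).
under [X in _ + _ *: X]eq_bigr => k _ do under eq_bigr => m _ do rewrite -/(U k m).
have l1 : lift ord0 ord0 = 1 :> 'I_2 by apply: val_inj.
rewrite !big_ord_recl !big_ord0 !mxE l1 -[ord0]/(0 : 'I_2).
by case: (ord2P (b s)) (ord2P (b l)) => -> [] -> /=;
  rewrite -[2^-1 *: _]/(2^-1 * _ : F); field.
Qed.

(** The number of factors equal to f v_1; the basis tensor [b] has weight n - 2 [flips b]. *)
Definition flips b : nat := #|[set i | b i == 1]|.

(** The index of the basis tensor f^(i) v_1 (x) ... (x) v_1. *)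
Definition flip1 (i : 'I_n) : {ffun 'I_n -> 'I_2} := [ffun j => if j == i then 1
  else 0].

Lemma flip1_inj : injective flip1.
Proof. by move=> i j /ffunP/(_ i); rewrite !ffunE eqxx;
  case: eqP => // _ /(congr1 val). Qed.

Lemma swap_flip1 s l i : swap s l (flip1 i) = flip1 (tperm s l i).
Proof. by apply/ffunP=> j; rewrite !ffunE -[in RHS](inj_eq (@perm_inj _ (tperm s
  l))) tpermK. Qed.

Lemma set_index0 i : set_index [ffun=> 0] i 1 = flip1 i.
Proof. by apply/ffunP=> j; rewrite !ffunE. Qed.

Lemma flips1P b : reflect (exists i, b = flip1 i) (flips b == 1%N).
Proof.
apply: (iffP cards1P) => [[i bi]|[i ->]]; exists i.
  apply/ffunP=> j; rewrite ffunE -in_set1 -bi inE.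
  by case: (ord2P (b j)) => ->.
by apply/setP=> j; rewrite !inE ffunE; case: (j == i).
Qed.

Lemma flips0 b : flips b = 0%N -> b = [ffun=> 0].
Proof.
move=> /cards0_eq b0; apply/ffunP=> i; rewrite ffunE.
by have := in_set0 i; rewrite -b0 inE; case: (ord2P (b i)) => ->.
Qed.

Lemma set_index_flips b i : b i = 0 -> flips (set_index b i 1) = (flips b).+1.
Proof.
move=> bi; rewrite /flips (_ : [set j | _] = i |: [set j | b j == 1]).
  by rewrite cardsU1 inE bi.
by apply/setP=> j; rewrite !inE ffunE; case: (eqVneq j i).
Qed.

Lemma total_h_E u b : Defs.total n (sl2_h F) u b = (n%:R - 2 * (flips b)%:R) * u b.
Proof.
rewrite sum_lfunE sum_ffunE /flips -sum1dep_card natr_sum mulr_sumr.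
rewrite -[in n%:R](card_ord n) -sum1_card natr_sum [X in _ - X]big_mkcond -sumrB
  mulr_suml.
apply: eq_bigr => i _; rewrite siteE !big_ord_recl big_ord0 !mxE.
have l1 : lift ord0 ord0 = 1 :> 'I_2 by apply: val_inj.
rewrite l1 -[ord0]/(0 : 'I_2); have := set_index_id b i.
case: (ord2P (b i)) => -> /= ->; last by rewrite mulr1; ring.
by ring.
Qed.

Lemma total_e_E u b : Defs.total n (sl2_e F) u b = \sum_(i | b i == 0) u (set_index
  b i 1).
Proof.
rewrite sum_lfunE sum_ffunE [RHS]big_mkcond; apply: eq_bigr => i _.
rewrite siteE !big_ord_recl big_ord0 !mxE.
have l1 : lift ord0 ord0 = 1 :> 'I_2 by apply: val_inj.
by rewrite l1; case: (ord2P (b i)) => -> /=; rewrite !(mul0r, mul1r, addr0, add0r).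
Qed.

Hypothesis charF : forall k, (0 < k <= n)%N -> k%:R != 0 :> F.

(** The weight of [b] differs from n - 2 by 2 (1 - [flips b]), which is nonzero in F because
    [flips b] is at most [n]. *)
Lemma flips_Sing u b : (2 <= n)%N -> u \in Sing F n -> flips b != 1%N -> u b = 0.
Proof.
move=> n2; rewrite mem_Sing => /andP[/eqP/ffunP/(_ b) hu _] b1.
have bn : (flips b <= n)%N by rewrite -[n in (_ <= n)%N]card_ord max_card.
move: hu; rewrite total_h_E ffunE => /eqP; rewrite -subr_eq0 -mulrBl mulf_eq0.
case/orP=> [|/eqP//]; rewrite (_ : _ - _ = 2 * (1 - (flips b)%:R)); last by ring.
rewrite mulf_eq0 (negPf F2) /= => bE.
case: (ltngtP (flips b) 1) b1 => // [b0|b1] _.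
  by move: bE; rewrite (_ : flips b = 0)%N ?subr0 ?oner_eq0 //; lia.
have := charF (k := flips b - 1); rewrite natrB; last by lia.
by rewrite -opprB oppr_eq0 bE => /(_ _) /negP; case=> //; lia.
Qed.

Lemma sum_Sing u : u \in Sing F n -> \sum_i u (flip1 i) = 0.
Proof.
rewrite mem_Sing => /andP[_ /eqP/ffunP/(_ [ffun=> 0])].
rewrite total_e_E [RHS]ffunE => e0; rewrite -[RHS]e0; apply: eq_big => i;
  first by rewrite ffunE.
by rewrite set_index0.
Qed.

Definition flip_tens (c : 'I_n -> F) : tens F n :=
  [ffun b => \sum_i (b == flip1 i)%:R * c i].

Lemma flip_tensE c i : flip_tens c (flip1 i) = c i.
Proof.
rewrite ffunE (bigD1 i) //= eqxx mul1r big1 ?addr0 // => j ji.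
by rewrite (inj_eq flip1_inj) eq_sym (negPf ji) mul0r.
Qed.

Lemma flip_tens0 c b : flips b != 1%N -> flip_tens c b = 0.
Proof.
move=> b1; rewrite ffunE big1 // => i _; case: eqP; rewrite ?mul0r // => bE.
by case/flips1P: b1; exists i.
Qed.

(** Applying e leaves only the coordinate at v_1 (x) ... (x) v_1, which is the sum of the c_i; at
    any other index, a further flip yields at least two. *)
Lemma flip_tens_Sing c : \sum_i c i = 0 -> flip_tens c \in Sing F n.
Proof.
move=> c0; rewrite mem_Sing; apply/andP; split; apply/eqP/ffunP=> b.
  rewrite total_h_E [RHS]ffunE; case: (eqVneq (flips b) 1%N) => [->|b1].
    by rewrite mulr1.
  by rewrite flip_tens0 // mulr0 scaler0.
rewrite total_e_E [RHS]ffunE; case: (eqVneq (flips b) 0%N) => [/flips0->|b0].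
  rewrite -[RHS]c0; apply: eq_big => i; first by rewrite ffunE.
  by rewrite set_index0 flip_tensE.
by rewrite big1 // => i /eqP bi; rewrite flip_tens0 // set_index_flips.
Qed.

End Tensors.

(** * The Gaudin Hamiltonians as multiplication operators on F[t] / (P) *)

Section Bethe.

Variables (F : fieldType) (n : nat) (z : 'I_n -> F).
Hypothesis n_ge2 : (2 <= n)%N.
Hypothesis charF : forall k, (0 < k <= n)%N -> k%:R != 0 :> F.
Hypothesis z_inj : injective z.

Let P := sum_cofac z.

Lemma two_neq0 : 2 != 0 :> F.
Proof. exact: (charF (k := 2)). Qed.

Lemma n_neq0 : n%:R != 0 :> F.
Proof. by apply: charF; rewrite leqnn andbT (ltn_trans _ n_ge2). Qed.

Definition Theta (u : tens F n) : {poly F} := \sum_i u (flip1 i) *: cofac z i.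

Lemma Theta_linear : linear Theta.
Proof.
move=> a u v; rewrite /Theta scaler_sumr -big_split; apply: eq_bigr => i _ /=.
by rewrite !ffunE scalerDl scalerA.
Qed.

HB.instance Definition _ :=
  GRing.isLinear.Build F (tens F n) {poly F} _ Theta Theta_linear.

(** By degrees [Theta u] is a scalar multiple c P. As the cofactors are independent, all coordinates
    equal c; their sum n c vanishes, so c = 0. *)
Lemma Theta_inj u : u \in Sing F n -> P %| Theta u -> u = 0.
Proof.
move=> uS /dvdpP[q uP]; have sP : size P = n := size_sum_cofacs z n_neq0.
have [c uc] : exists c, Theta u = c *: P.
  case: (eqVneq q 0) uP => [->|q0] uP.
    by exists 0; rewrite uP mul0r scale0r.
  have P0 : P != 0 by rewrite -size_poly_eq0 sP; lia.
  have := size_sum_cofac z (fun i => u (flip1 i));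
    rewrite -/(Theta u) uP size_mul // sP.
  have le1 a : ((a + n).-1 <= n -> a <= 1)%N by lia.
  move=> /le1/size1_polyC qC.
  by exists q`_0; rewrite {1}qC mul_polyC.
have {uc} uE : forall i, u (flip1 i) = c by apply: (cofac_free z_inj);
  rewrite -scaler_sumr.
have c0 : c = 0.
  have /eqP := sum_Sing uS; rewrite (eq_bigr (fun=> c)) // sumr_const card_ord.
  by rewrite -mulr_natr mulf_eq0 (negPf n_neq0) orbF => /eqP.
apply/ffunP=> b; rewrite [RHS]ffunE; case: (flips1P b) => [[i ->]|b1].
  by rewrite uE c0.
by apply: (flips_Sing two_neq0 charF n_ge2 uS); apply/negP => /flips1P.
Qed.

Lemma Theta_surj (q : {poly F}) : exists2 u, u \in Sing F n & P %| Theta u - q.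
Proof.
have sP : size P = n := size_sum_cofacs z n_neq0.
have P0 : P != 0 by rewrite -size_poly_eq0 sP; lia.
have rn : (size (q %% P)%R <= n)%N by rewrite ltnW // -sP ltn_modpN0.
pose c i := (q %% P).[z i] / (cofac z i).[z i].
(* Subtracting the mean puts the vector in Sing and changes its image under [Theta] by m P only. *)
pose m := (\sum_i c i) / n%:R.
exists (flip_tens (fun i => c i - m)).
  apply: flip_tens_Sing; rewrite sumrB sumr_const card_ord -mulr_natr divfK ?subrr //.
  exact: n_neq0.
rewrite /Theta; under eq_bigr => i _ do rewrite flip_tensE scalerBl.
rewrite sumrB -(cofac_span z_inj rn) -scaler_sumr -/P -mul_polyC.
by rewrite {2}(divp_eq q P) addrAC opprD addrCA subrr addr0 -opprD dvdpNr -mulrDl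
  dvdp_mull.
Qed.

(** The eigenvalue of H_s on v_1 (x) ... (x) v_1, where each Omega acts as 1 - 1/2. *)
Definition gaudin_shift s : F := \sum_(l < n | l != s) (z s - z l)^-1 * (1 - 2^-1).

Lemma gaudinH_flip1 s u i : gaudinH z s u (flip1 i) =
  gaudin_shift s * u (flip1 i)
  + \sum_(l < n | l != s) (z s - z l)^-1 * (u (flip1 (tperm s l i)) - u (flip1 i)).
Proof.
rewrite sum_lfunE sum_ffunE mulr_suml -big_split; apply: eq_bigr => l ls.
rewrite scale_lfunE ffunE OmegaE ?two_neq0 1?eq_sym // swap_flip1.
rewrite -[_ *: _]/(_ * _ : F).
have alg (a x y : F) : a * (x - 2^-1 * y) = a * (1 - 2^-1) * y + a * (x - y) by ring.
exact: alg.
Qed.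

(** A division-free form of the claim that H_s minus its shift is multiplication by (t - z_s)^-1
    modulo P. *)
Lemma Theta_gaudinH s u :
  ('X - (z s)%:P) * (Theta (gaudinH z s u) - gaudin_shift s *: Theta u) =
  Theta u - u (flip1 s) *: P.
Proof.
have -> : Theta (gaudinH z s u) - gaudin_shift s *: Theta u =
    \sum_(l < n | l != s) (u (flip1 l) - u (flip1 s)) *:
      \prod_(i < n | (i != l) && (i != s)) ('X - (z i)%:P).
  have -> : Theta (gaudinH z s u) - gaudin_shift s *: Theta u = \sum_i \sum_(l < n
    | l != s)
      ((z s - z l)^-1 * (u (flip1 (tperm s l i)) - u (flip1 i))) *: cofac z i.
    rewrite /Theta scaler_sumr -sumrB; apply: eq_bigr => i _.
    by rewrite scalerA -scalerBl gaudinH_flip1 addrC addKr scaler_suml.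
  rewrite exchange_big; apply: eq_bigr => l ls.
  under eq_bigr => i _ do rewrite -scalerA.
  (* The transposition of s and l fixes all other indices, whose terms vanish. The remaining two
     give a difference of cofactors, whose factor z_l - z_s cancels the denominator. *)
  rewrite -scaler_sumr (bigD1 s) //= (bigD1 l) //= tpermL tpermR big1 ?addr0 => [|i
    /andP[si li]].
    rewrite -[X in _ + X *: _]opprB scaleNr -scalerBr -[cofac z s - _]opprB
      cofac_XsubC //.
    rewrite mul_polyC -scaleNr opprB !scalerA mulrAC mulVf ?mul1r //.
    by rewrite subr_eq0 (inj_eq z_inj) eq_sym.
  by rewrite tpermD 1?eq_sym // subrr scale0r.
rewrite mulr_sumr /Theta scaler_sumr -sumrB [RHS](bigD1 s) //= subrr add0r.
apply: eq_bigr => l ls; rewrite -scalerAr -scalerBl; congr (_ *: _).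
by rewrite /cofac [RHS](bigD1 s) 1?eq_sym.
Qed.

(* [Theta] transports [E] to multiplication by [q] on [F[t] / (P)]. *)
Definition multiplies (q : {poly F}) (E : 'End(subvs_of (Sing F n))) :=
  forall w, P %| Theta (vsval (E w)) - q * Theta (vsval w).

(** The two images agree modulo P after [Theta], which is injective on Sing modulo P. *)
Lemma multiplies_inj q q' E E' : P %| q - q' ->
  multiplies q E -> multiplies q' E' -> E = E'.
Proof.
move=> qq' qE qE'; apply/lfunP=> w; apply/val_inj/eqP; rewrite -subr_eq0; apply/eqP.
apply: Theta_inj; first by rewrite rpredB ?subvsP.
have alg (x y t a b : {poly F}) : x - y = (x - a * t) - (y - b * t) + (a - b) * t
  by ring.
rewrite linearB /= (alg _ _ (Theta (vsval w)) q q').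
by apply: dvdp_add; [apply: dvdp_sub | apply: dvdp_mulr].
Qed.

Lemma multiplies1 : multiplies 1 \1%VF.
Proof. by move=> w; rewrite id_lfunE mul1r subrr dvdp0. Qed.

Lemma multipliesP a q q' E E' :
  multiplies q E -> multiplies q' E' -> multiplies (a *: q + q') (a *: E + E').
Proof.
move=> qE qE' w; rewrite add_lfunE scale_lfunE !linearP /= mulrDl -scalerAl.
rewrite opprD addrACA -scalerBr; apply: dvdp_add => //.
by rewrite -mul_polyC dvdp_mull.
Qed.

Lemma multipliesM q q' E E' :
  multiplies q E -> multiplies q' E' -> multiplies (q * q') (E \o E')%VF.
Proof.
move=> qE qE' w; have alg (x y t a b : {poly F}) : x - a * b * t = (x - a * y) + a
  * (y - b * t) by ring.
rewrite comp_lfunE (alg _ (Theta (vsval (E' w)))).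
by apply: dvdp_add => //; apply: dvdp_mull.
Qed.

Lemma multiplies_gaudinH s : exists q, multiplies q (gaudinH_res z s).
Proof.
have /Bezout_eq1_coprimepP[[a b] /= ab] := coprime_XsubC_sum_cofac z_inj s.
(* By the Bezout relation, [b] is an inverse of t - z_s modulo P. *)
exists ((gaudin_shift s)%:P + b) => w; rewrite gaudinH_resE ?two_neq0 //.
have alg (x y k c l p : {poly F}) : l * (x - k * y) = y - c * p -> a * p + b * l = 1 ->
    x - (k + b) * y = (a * (x - k * y) - b * c) * p.
  move=> xy ab1; have -> : x - (k + b) * y = 1 * (x - k * y) - b * y by ring.
  by rewrite -ab1 mulrDl -[b * l * _]mulrA xy; ring.
have := Theta_gaudinH s (vsval w); rewrite -mul_polyC -[_ *: P]mul_polyC.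
by move/alg => ->; rewrite ?dvdp_mull.
Qed.

Lemma bethe_multiplies (E : bethe_alg z) : exists q, multiplies q (val E).
Proof.
case: E => E /= /asboolP/(_ (fun f => exists q, multiplies q f)); apply; last first.
  exact: multiplies_gaudinH.
split=> [|a f g [q qf] [q' qg]|f g [q qf] [q' qg]].
- by exists 1; apply: multiplies1.
- by exists (a *: q + q'); apply: multipliesP.
- by exists (q * q'); apply: multipliesM.
Qed.

Let T : {poly F} := \prod_(s < n) ('X - (z s)%:P).

(** Expanding q T modulo P in the cofactors and dividing by T writes q as a combination of the (t -
    z_s)^-1; the same combination of the shifted Hamiltonians multiplies by q. *)
Lemma multiplies_bethe q : exists E : bethe_alg z, multiplies q (val E).
Proof.
have sP : size P = n := size_sum_cofacs z n_neq0.
have P0 : P != 0 by rewrite -size_poly_eq0 sP; lia.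
pose r : {poly F} := (q * T) %% P.
have rn : (size r <= n)%N by rewrite ltnW // -sP ltn_modpN0.
pose d i := r.[z i] / (cofac z i).[z i].
have rE : r = \sum_i d i *: cofac z i := cofac_span z_inj rn.
pose E := \sum_s d s *: (gaudinH_res z s - gaudin_shift s *: \1%VF).
have EB : E \in in_bethe z.
  apply: rpred_sum => s _; apply: rpredZ; apply: rpredB; first exact: gaudinH_bethe.
  by apply/rpredZ/bethe_one_subproof.
exists (Sub E EB) => w; rewrite SubK.
have TE : T * Theta (vsval (E w)) = r * Theta (vsval w) - (\sum_s (d s * vsval w
  (flip1 s)) *: cofac z s) * P.
  have -> : Theta (vsval (E w)) = \sum_s d s *:
      (Theta (gaudinH z s (vsval w)) - gaudin_shift s *: Theta (vsval w)).
    rewrite sum_lfunE !linear_sum; apply: eq_bigr => s _.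
    rewrite scale_lfunE add_lfunE opp_lfunE scale_lfunE id_lfunE !linearZ /=.
    by rewrite gaudinH_resE ?two_neq0 // linearD linearZ /= linearN.
  rewrite [r in RHS]rE mulr_sumr !mulr_suml -sumrB; apply: eq_bigr => s _.
  rewrite -scalerAr /T (cofacE z s) mulrAC Theta_gaudinH -!scalerAl -scalerA -scalerBr.
  by congr (_ *: _); rewrite -!mul_polyC; ring.
(* Divisibility by P may be tested after multiplication by T, which is coprime to P. *)
rewrite -(Gauss_dvdpr _ (coprime_prod_sum_cofac z_inj)) -/T mulrBr TE.
rewrite {1}(_ : r = q * T - (q * T) %/ P * P);
  last by rewrite {1}(divp_eq (q * T) P) addrC addKr.
set c := \sum_s _; move: (Theta _) => t.
have -> : (q * T - (q * T) %/ P * P) * t - c * P - T * (q * t) = - ((q * T) %/ P *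
  t + c) * P.
  by ring.
exact: dvdp_mull.
Qed.

End Bethe.

(** * Comparison of the three algebras and of the module Sing *)

Theorem corollary4p9 (n p : nat) (z : 'I_n -> 'F_p) (n_ge2 : (2 <= n)%N)
    (p_prime : prime p) (p_gt : (n + 1 < p)%N) (z_inj : injective z) :
  let T : {poly 'F_p} := \prod_(s < n) ('X - (z s)%:P) in
  [/\ exists f : OU_quot z -> bethe_alg z, alg_iso f,
      exists g : bethe_alg z -> wronski_alg n T, alg_iso g
    & exists (psi : wronski_alg n T -> bethe_alg z)
             (phi : wronski_alg n T -> subvs_of (Sing 'F_p n)),
        [/\ alg_iso psi, linear phi, bijective phi
          & forall g h, phi (g * h) = val (psi g) (phi h)]].
Proof.
move=> T; have charF k : (0 < k <= n)%N -> k%:R != 0 :> 'F_p.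
  move=> /andP[k0 kn]; rewrite -(dvdn_pcharf (pchar_Fp p_prime)) gtnNdvd //; lia.
have sT : size T = n.+1 by rewrite /T size_prod_XsubC /index_enum unlock -enumT
  size_enum_ord.
have TM : T \is monic := monic_prod_XsubC _ _ _.
have dT : T^`() = sum_cofac z := deriv_prod_XsubC z.
pose fA := quot_horner [:: OU_P z] (OU_t z).
pose fC := quot_horner (C_rel n T) (C_t 'F_p n).
have fAS : forall x, exists q, fA q = x := quot_horner_OU_surj z_inj.
have fAL : linear fA by apply: quot_horner_linear.
have fAM : monoid_morphism fA by apply: quot_horner_monoid_morphism.
have fAE q r : fA q = fA r <-> sum_cofac z %| q - r.
  by apply: horner_fibre => {q r} q; apply: quot_horner_OU_eq0.
have fCS : forall x, exists q, fC q = x by apply: quot_horner_C_surj.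
have fCL : linear fC by apply: quot_horner_linear.
have fCM : monoid_morphism fC by apply: quot_horner_monoid_morphism.
have fCE q r : fC q = fC r <-> sum_cofac z %| q - r.
  by rewrite -dT; apply: horner_fibre => {q r} q; apply: quot_horner_C_eq0.
(* [fB q] is the element of the Bethe algebra that multiplies by q; its uniqueness makes [fB] linear
   and multiplicative. *)
have /choice[fB fBP] := multiplies_bethe n_ge2 charF z_inj.
have fB_eq q (E : bethe_alg z) : multiplies z q (val E) -> fB q = E.
  move=> qE; apply: val_inj; apply: (multiplies_inj n_ge2 charF z_inj _ (fBP q) qE).
  by rewrite subrr dvdp0.
have fBS E : exists q, fB q = E.
  by have [q /fB_eq] := bethe_multiplies n_ge2 charF z_inj E; exists q.
have fBL : linear fB by move=> a q r; apply/fB_eq/multipliesP.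
have fBM : monoid_morphism fB.
  by split=> [|q r]; apply: fB_eq; [apply: multiplies1 | apply: multipliesM].
(* The vector with image 1 modulo P is cyclic for the Bethe algebra. *)
have [u0 u0S u0E] := Theta_surj n_ge2 charF z_inj 1.
pose w0 := vsproj (Sing 'F_p n) u0.
have Theta_w q : sum_cofac z %| Theta z (vsval (val (fB q) w0)) - q.
  have := fBP q w0; rewrite vsprojK // => qE.
  have alg (x y : {poly 'F_p}) : x - q = (x - q * y) + q * (y - 1) by ring.
  rewrite (alg _ (Theta z u0)).
  by apply: dvdp_add; [exact: qE | apply: dvdp_mull].
have fBE q r : fB q = fB r <-> sum_cofac z %| q - r.
  split=> [qr|qr]; last by apply/val_inj/(multiplies_inj n_ge2 charF z_inj qr).
  have alg (x : {poly 'F_p}) : q - r = (x - r) - (x - q) by ring.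
  rewrite (alg (Theta z (vsval (val (fB q) w0)))).
  by apply: dvdp_sub; [rewrite qr|]; apply: Theta_w.
have w0_eq q w : sum_cofac z %| Theta z (vsval w) - q <-> val (fB q) w0 = w.
  split=> [qw|<-]; last exact: Theta_w.
  apply/val_inj/eqP; rewrite -subr_eq0; apply/eqP.
  apply: (Theta_inj n_ge2 charF z_inj); first by rewrite rpredB ?subvsP.
  have alg (x y : {poly 'F_p}) : x - y = (x - q) - (y - q) by ring.
  by rewrite linearB /= (alg _ (Theta z (vsval w))) dvdp_sub // Theta_w.
split.
- have [q r|f fb ff] := factor_bij fAS fBS; first by rewrite fAE fBE.
  exists f; split=> //; first exact: factor_linear ff _ _.
  exact: factor_monoid_morphism ff _ _.
- have [q r|f fb ff] := factor_bij fBS fCS; first by rewrite fCE fBE.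
  exists f; split=> //; first exact: factor_linear ff _ _.
  exact: factor_monoid_morphism ff _ _.
have [q r|psi psib psif] := factor_bij fCS fBS; first by rewrite fCE fBE.
(* Acting on the cyclic vector presents Sing as one more quotient of F[t] with kernel (P). *)
pose fS q := val (fB q) w0.
have fSS w : exists q, fS q = w.
  by exists (Theta z (vsval w)); apply/w0_eq; rewrite subrr dvdp0.
have fSE q r : fS q = fS r <-> sum_cofac z %| q - r.
  split=> [/w0_eq qr|/fBE qr]; last by rewrite /fS qr.
  have alg (x : {poly 'F_p}) : q - r = (x - r) - (x - q) by ring.
  rewrite (alg (Theta z (vsval (fS r)))) dvdp_sub //; exact: Theta_w.
have fSL : linear fS by move=> a q r; rewrite /fS fBL /= add_lfunE scale_lfunE.
have [q r|phi phib phif] := factor_bij fCS fSS; first by rewrite fCE fSE.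
exists psi, phi; split=> // [||x y].
- split=> //; first exact: factor_linear psif _ _.
  exact: factor_monoid_morphism psif _ _.
- exact: factor_linear phif _ _.
(* On classes of polynomials, [phi] sends q r to [fB q] applied to [fB r] applied to [w0]. *)
have [[q <-] [r <-]] := (fCS x, fCS y); rewrite -fCM.2 !phif psif.
by rewrite /fS fBM.2 /= comp_lfunE.
Qed.
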